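(* For each integer $\ell \geq 5$, a graph $G$ is proportionally $(2,\ell)$-choosable if and only if $G$ is a linear forest such that the largest component of $G$ has at most $5$ vertices and all other components of $G$ have at most $2$ vertices.
   Context: All graphs are nonempty, finite and simple. For $m\in\mathbb{N}=\{1,2,3,\ldots\}$, $[m]=\{1,\ldots,m\}$. A linear forest is a disjoint union of paths (a single vertex is a path). ''The largest component'' means one fixed component of maximum order; ''all other components'' means every component different from that one. For integers $1\le k\le \ell$, a $(k,\ell)$-assignment for a graph $G$ is a function $L$ assigning to each vertex $v$ of $G$ a set $L(v)\subseteq[\ell]$ with $|L(v)|=k$. Let $\mathcal{L}=\bigcup_{v\in V(G)}L(v)$ and, for $c\in\mathcal{L}$, let $\eta(c)=|\{v\in V(G): c\in L(v)\}|$. A proportional $L$-coloring of $G$ is a function $f$ on $V(G)$ with $f(v)\in L(v)$ for every $v$, with $f(u)\ne f(v)$ whenever $u,v$ are adjacent, and with $|f^{-1}(c)|\in\{\lfloor \eta(c)/k\rfloor,\lceil \eta(c)/k\rceil\}$ for every $c\in\mathcal{L}$. $G$ is proportionally $(k,\ell)$-choosable if a proportional $L$-coloring of $G$ exists for every $(k,\ell)$-assignment $L$ for $G$. *)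

(* Defs.v *)
(* MathComp *)
From mathcomp Require Import all_boot.

Set Implicit Arguments.
Unset Strict Implicit.
Unset Printing Implicit Defensive.

Section Graph.

(* The adjacency relation of a graph on T; that it is simple (symmetric and
   irreflexive) is assumed where it is used. *)
Variables (T : finType) (e : rel T).

Definition components : {set {set T}} :=
  equivalence_partition (connect e) [set: T].

(* s lists C without repetition, and the edges of the subgraph induced on C are
   exactly the pairs of vertices that are consecutive in s. *)
Definition induces_path (C : {set T}) : Prop :=
  exists s : seq T,
    [/\ uniq s,
        s =i C &
        forall x y, x \in C -> y \in C ->
          e x y = (index y s == (index x s).+1) || (index x s == (index y s).+1)].

Definition linear_forest : Prop :=
  forall C, C \in components -> induces_path C.

(* When several components have maximum order, the choice of C does not affect
   the condition. *)
Definition largest_le_others_le (m n : nat) : Prop :=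
  exists C : {set T},
    [/\ C \in components,
        forall D, D \in components -> #|D| <= #|C|,
        #|C| <= m &
        forall D, D \in components -> D != C -> #|D| <= n].

Section Coloring.

(* The palette {1, ..., l} is encoded as 'I_l = {0, ..., l - 1}. *)
Variables k l : nat.

Definition assignment (L : T -> {set 'I_l}) : Prop := forall v, #|L v| = k.

Definition palette (L : T -> {set 'I_l}) : {set 'I_l} := \bigcup_v L v.

Definition eta (L : T -> {set 'I_l}) (c : 'I_l) : nat := #|[set v | c \in L v]|.

(* The ceiling of n / d, for d > 0. *)
Definition ceil_divn (n d : nat) : nat := (n + d.-1) %/ d.

Definition proportional_coloring (L : T -> {set 'I_l}) (f : T -> 'I_l) : Prop :=
  [/\ forall v, f v \in L v,
      forall u v, e u v -> f u != f v &
      forall c, c \in palette L ->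
        #|f @^-1: [set c]| = eta L c %/ k \/
        #|f @^-1: [set c]| = ceil_divn (eta L c) k].

(* Meaningful for 1 <= k <= l. *)
Definition proportionally_choosable : Prop :=
  forall L : T -> {set 'I_l}, assignment L ->
    exists f : T -> 'I_l, proportional_coloring L f.

End Coloring.

End Graph.

(* Main.v *)
Require Import Defs.
From mathcomp Require Import all_boot.
From mathcomp Require Import zify.

(* With lists of size 2, a vertex v with list {c, d} is an edge joining the colours
   c and d, and choosing a colour orients that edge; a coloring is proportional when
   in- and out-degrees differ by at most 1 at every colour.  Pairing half-edges at each
   colour, with at most one left over, gives together with the two halves of
   each edge a pair of involutions on half-edges.  A 2-coloring alternating along both is
   a proportional choice, and so is its complement.  Pairing u with v at a colour c
   forces exactly one of them to receive c, which settles the components K_2.  On the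
   path v_1...v_5, a colour outside the list {c, d} of v_3 causes conflicts only along
   v_1v_2 and v_4v_5, and for c and d one of four pairing patterns leaves only
   conflicts that are removed by passing to the complement, if necessary.

   Conversely, claws, cycles of length 3, 4, 5 and pairs of disjoint paths on 3 vertices
   are excluded by explicit lists, extended by one constant list to the other vertices. *)

Set Implicit Arguments.
Unset Strict Implicit.
Unset Printing Implicit Defensive.


(** * Alternating bits along two involutions *)

(** Swapping two fixed points with equal [kappa] lowers the number of fixed points, so repeating
    this ends with at most one per value. *)
Lemma involution_extend (H : finType) (K : eqType) (kappa : H -> K) (t : H -> H) :
    involutive t -> (forall x, kappa (t x) = kappa x) ->
  exists t' : H -> H,
    [/\ involutive t',
        forall x, kappa (t' x) = kappa x,
        forall x, t x != x -> t' x = t x &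
        forall x y, t' x = x -> t' y = y -> kappa x = kappa y -> x = y].
Proof.
have [n] := ubnP #|[pred x | t x == x]|.
elim: n t => // n IHn t; rewrite ltnS => le_n tK kt.
case: (pickP [pred p : H * H | [&& t p.1 == p.1, t p.2 == p.2,
    kappa p.1 == kappa p.2 & p.1 != p.2]]) => [[x y] /= | nop].
  case/and4P=> /eqP tx /eqP ty /eqP kxy nxy.
  pose t1 := [fun z => t z with x |-> y, y |-> x].
  have tz z : z != x -> z != y -> (t z != x) && (t z != y).
    by move=> zx zy; rewrite -[in t z != x]tx -[in t z != y]ty !(inj_eq (inv_inj tK)) zx.
  have t1K : involutive t1.
    move=> z /=; case: (eqVneq z x) => [-> | zx]; first by rewrite eqxx eq_sym (negPf nxy).
    case: (eqVneq z y) => [-> | zy]; first by rewrite eqxx.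
    by have /andP[/negPf-> /negPf->] := tz z zx zy.
  have kt1 z : kappa (t1 z) = kappa z.
    by rewrite /=; case: eqP => [->|_]; last case: eqP => [->|_].
  have [|t' [t'K kt' t'E inj]] := IHn t1 _ t1K kt1.
    apply: leq_trans le_n; apply: proper_card; apply/properP; split.
      apply/subsetP=> z; rewrite !inE /=.
      case: (eqVneq z x) => [-> | zx]; first by rewrite eq_sym (negPf nxy).
      by case: (eqVneq z y) => [->|//]; rewrite (negPf nxy).
    by exists x; rewrite !inE /= ?tx // eqxx eq_sym.
  exists t'; split=> // z tzz.
  have zx : z != x by apply: contraNneq tzz => ->; rewrite tx.
  have zy : z != y by apply: contraNneq tzz => ->; rewrite ty.
  by rewrite t'E /= (negPf zx) (negPf zy).
exists t; split=> // x y tx ty kxy; apply/eqP; have := nop (x, y).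
by rewrite /= tx ty kxy !eqxx /= => /negbFE.
Qed.

(** The orbits under [s] and [t] are even cycles, or paths ending in fixed points of [t], hence
    bipartite. The induction replaces a stretch [t], [s], [t] by a single [t]-edge. *)
Lemma involutions_bicolor (H : finType) (A : {set H}) (s t : H -> H) :
    {in A, forall x, [/\ s x \in A, s (s x) = x & s x != x]} ->
    {in A, forall x, t x \in A /\ t (t x) = x} ->
  exists b : H -> bool,
    {in A, forall x, b (s x) = ~~ b x /\ (t x != x -> b (t x) = ~~ b x)}.
Proof.
have [n] := ubnP #|A|; elim: n A t => // n IHn A t; rewrite ltnS => le_n sP tP.
have [->|[h hA]] := set_0Vmem A; first by exists xpredT => x; rewrite inE.
have [shA ssh nsh] := sP h hA.
pose B := A :\ h :\ s h.
have BE x : (x \in B) = [&& x != s h, x != h & x \in A] by rewrite !inE.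
have [thA tth] := tP h hA; have [tshA ttsh] := tP _ shA.
(* The fallback [x] becomes a fixed point of [t1] when the partner to be inherited is not in [B]. *)
pose w y x := if y \in B then y else x.
(* Delete h and s h, and let t pair their former partners. *)
pose t1 x := if t x == h then w (t (s h)) x else if t x == s h then w (t h) x else t x.
have sB : {in B, forall x, [/\ s x \in B, s (s x) = x & s x != x]}.
  move=> x; rewrite !BE => /and3P[xsh xh xA]; have [sxA ssx nsx] := sP x xA; split=> //.
  rewrite sxA andbT; apply/andP; split; apply/eqP => E.
    by move: xh; rewrite -ssx E ssh eqxx.
  by move: xsh; rewrite -ssx E eqxx.
have t1B : {in B, forall x, t1 x \in B /\ t1 (t1 x) = x}.
  move=> x xB; move: (xB); rewrite BE => /and3P[xsh xh xA].
  have [txA ttx] := tP x xA.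
  rewrite /t1 /w; case: (eqVneq (t x) h) => [E|txh].
    have xE : t h = x by rewrite -E.
    case: ifP => [yB|_]; last by rewrite E eqxx.
    rewrite ttsh (negPf nsh) eqxx xE xB; split=> //.
  case: (eqVneq (t x) (s h)) => [E|txsh].
    have xE : t (s h) = x by rewrite -E.
    case: ifP => [yB|nB]; last by rewrite E (negPf nsh) eqxx.
    by rewrite tth eqxx xE xB.
  by rewrite ttx (negPf xh) (negPf xsh) BE txsh txh txA.
have [|b bP] := IHn B t1 _ sB t1B.
  apply: leq_trans le_n; apply: proper_card; apply/properP; split.
    by apply/subsetP=> x; rewrite BE => /and3P[].
  by exists h; rewrite // BE eqxx andbF.
(* The bit of [h] must differ from that of [t h], and the bit of [s h] from that of [t (s h)]. If
   both partners lie in [B], then [t1] pairs them and the two demands agree. *)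
pose bh := if t h \in B then ~~ b (t h) else if t (s h) \in B then b (t (s h)) else true.
exists (fun x => if x == h then bh else if x == s h then ~~ bh else b x) => x xA.
have [->|xh] := eqVneq x h.
  rewrite (negPf nsh) eqxx; split=> // nth; rewrite (negPf nth).
  have [//|tsh] := eqVneq (t h) (s h).
  by rewrite /bh BE tsh nth thA negbK.
have [->|xsh] := eqVneq x (s h).
  rewrite ssh eqxx negbK; split=> // nt; rewrite (negPf nt).
  have [//|th] := eqVneq (t (s h)) h.
  have tshB : t (s h) \in B by rewrite BE nt th.
  rewrite /bh tshB; case: ifP => [thB|//].
  have [_] := bP _ thB.
  rewrite /t1 tth eqxx /w tshB => -> //; apply: contraTneq tshB => E.
  have : t (t (s h)) = t (t h) by rewrite E.
  by rewrite ttsh tth => E'; rewrite E' eqxx in nsh.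
have xB : x \in B by rewrite BE xsh xh.
have [sxB ssx _] := sB x xB; have [bs bt] := bP x xB.
move: sxB; rewrite BE => /and3P[/negPf-> /negPf-> _]; split=> // ntx.
have [txA ttx] := tP x xA; move: bt; rewrite /t1 /w.
case: (eqVneq (t x) h) => [E|txh].
  have xE : t h = x by rewrite -E.
  by rewrite /bh xE xB.
case: (eqVneq (t x) (s h)) => [E|txsh]; last by move=> ->.
have xE : t (s h) = x by rewrite -E.
rewrite /bh xE xB; case: ifP => [thB|//] bt; rewrite negbK -bt //.
by apply: contraNneq nsh => E'; rewrite -ttsh xE -E' tth.
Qed.

(** * Balanced choices with prescribed pairs *)

(** Up to at most one fixed point, [t] maps the part of [A] inside [P] injectively into the part
    outside. Used for a set and its complement, this bounds the difference both ways. *)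
Lemma card_setI_le (H : finType) (A P : {set H}) (t : H -> H) :
    {in A, forall x, t x \in A /\ t (t x) = x} ->
    {in A &, forall x y, t x = x -> t y = y -> x = y} ->
    {in A, forall x, t x != x -> (t x \in P) = (x \notin P)} ->
  #|A :&: P| <= #|A :\: P|.+1.
Proof.
move=> tA t1 tP; pose F := [set x in A | t x == x].
have F1 : #|F| <= 1.
  apply/card_le1_eqP => x y; rewrite !inE => /andP[xA /eqP tx] /andP[yA /eqP ty].
  exact: t1.
have sub : A :&: P \subset F :|: t @: (A :\: P).
  apply/subsetP=> x; rewrite !inE => /andP[xA xP]; rewrite xA /=.
  case: eqP => //= /eqP tx; have [txA ttx] := tA x xA.
  by apply/imsetP; exists (t x); rewrite // !inE txA tP // xP.
apply: leq_trans (subset_leq_card sub) _; apply: leq_trans (leq_card_setU _ _) _.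
by rewrite -add1n leq_add ?leq_imset_card.
Qed.

(** Ranging over all colours adds nothing when [f] respects the lists: outside the palette, the
    colour class and [eta] are both zero. *)
Definition balanced (T : finType) l (L : T -> {set 'I_l}) (f : T -> 'I_l) : Prop :=
  forall c, #|f @^-1: [set c]| = eta L c %/ 2 \/
            #|f @^-1: [set c]| = ceil_divn (eta L c) 2.

(** The half-edges are the pairs [(v, c)] with [c \in L v]. One involution, [other], exchanges the
    two halves of an edge; the second extends [M] until at most one half-edge per colour is
    unpaired. The half-edges with bit [i] form [f i]. *)
Lemma balanced_choices (T : finType) l (L : T -> {set 'I_l}) (M : 'I_l -> T -> T) :
    assignment 2 L -> (forall c, involutive (M c)) ->
    (forall c v, (c \in L (M c v)) = (c \in L v)) ->
  exists f : bool -> T -> 'I_l,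
    [/\ forall i v, f i v \in L v,
        forall i, balanced L (f i),
        forall i c v, c \in L v -> M c v != v -> (f i (M c v) == c) = (f i v != c) &
        forall c v, c \in L v -> (f true v == c) = (f false v != c)].
Proof.
move=> L2 MK ML.
pose t (h : T * 'I_l) := (M h.2 h.1, h.2).
have tK : involutive t by case=> v c; rewrite /t /= MK.
have [|t' [t'K t'k t'E t'1]] :=
  (* Membership is part of the invariant so that the added pairs join half-edges only to
     half-edges. *)
  @involution_extend _ _ (fun h : T * 'I_l => (h.2, h.2 \in L h.1)) t tK.
  by case=> v c; rewrite /t /= ML.
pose A := [set h : T * 'I_l | h.2 \in L h.1].
have t'2 h : (t' h).2 = h.2 by have [] := t'k h.
have t'A h : (t' h \in A) = (h \in A) by rewrite !inE; have [_] := t'k h.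
pose other (h : T * 'I_l) := odflt h.2 [pick d in L h.1 :\ h.2].
have otherP v c : c \in L v -> L v = [set c; other (v, c)] /\ other (v, c) != c.
  move=> cL; rewrite /other; case: pickP => /= [d|no].
    rewrite !inE => /andP[dc dL]; split=> //; apply/esym/eqP.
    by rewrite eqEcard subUset !sub1set cL dL L2 cards2 eq_sym dc.
  have E0 : #|L v :\ c| = 0 by apply: eq_card0.
  by have := cardsD1 c (L v); rewrite L2 cL E0.
have [||b bP] := @involutions_bicolor _ A (fun h => (h.1, other h)) t'.
- case=> v c; rewrite !inE /= => cL; have [E oc] := otherP v c cL.
  have oL : other (v, c) \in L v by rewrite [L v]E !inE eqxx orbT.
  have [E' ooc] := otherP v _ oL; split=> //; last by rewrite xpair_eqE eqxx.
  congr (_, _); apply/eqP; have : c \in L v := cL.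
  by rewrite [L v]E' !inE eq_sym (negPf oc) /= eq_sym.
- by move=> h hA; rewrite t'A t'K.
have bo v c : c \in L v -> b (v, other (v, c)) = ~~ b (v, c).
  by move=> cL; have [] := bP (v, c); rewrite ?inE.
have exf i : exists f : T -> 'I_l, forall v, f v \in L v /\ b (v, f v) = i.
  apply: (@fin_all_exists T (fun=> 'I_l) (fun v c => c \in L v /\ b (v, c) = i)) => v.
  have /card_gt0P[c cL] : 0 < #|L v| by rewrite L2.
  have [E oc] := otherP v c cL; have [bc|bc] := eqVneq (b (v, c)) i; first by exists c.
  exists (other (v, c)); rewrite [L v]E !inE eqxx orbT bo //.
  by move: bc; case: (b _); case: i.
have [f0 f0P] := exf false; have [f1 f1P] := exf true.
pose f (i : bool) := if i then f1 else f0.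
have fP i v : f i v \in L v /\ b (v, f i v) = i by case: i; [exact: f1P|exact: f0P].
have fE i v c : c \in L v -> (f i v == c) = (b (v, c) == i).
  move=> cL; have [fL bf] := fP i v; have [E oc] := otherP v c cL.
  have [<-|nfc] := eqVneq (f i v) c; first by rewrite bf eqxx.
  move: (fL); rewrite [L v]E !inE (negPf nfc) /= => /eqP fo.
  by apply/esym/negbTE; rewrite -bf fo bo //; case: (b _).
exists f; split.
- by move=> i v; have [] := fP i v.
- move=> i c; pose S := [set v | c \in L v]; pose P := f i @^-1: [set c].
  pose u v := (t' (v, c)).1.
  have uE v : t' (v, c) = (u v, c) by rewrite [LHS]surjective_pairing t'2.
  have uS : {in S, forall v, u v \in S /\ u (u v) = v}.
    move=> v; rewrite !inE => cL; split; last by rewrite {1}/u -uE t'K.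
    by have := t'A (v, c); rewrite uE !inE /= cL.
  have u1 : {in S &, forall v w, u v = v -> u w = w -> v = w}.
    move=> v w; rewrite !inE => cv cw uv uw.
    have := t'1 (v, c) (w, c); rewrite !uE uv uw /= cv cw => H.
    by have [] := H erefl erefl erefl.
  have ub : {in S, forall v, u v != v -> b (u v, c) = ~~ b (v, c)}.
    move=> v; rewrite inE => cL nuv; have [] := bP (v, c); first by rewrite inE.
    by rewrite uE => _ -> //; rewrite xpair_eqE (negPf nuv).
  have uP : {in S, forall v, u v != v -> (u v \in P) = (v \notin P)}.
    move=> v vS nuv; have [uvS _] := uS v vS; move: (vS) (uvS); rewrite !inE => cv cu.
    by rewrite !fE // ub // -[i]negbK; case: (b _); case: (~~ i).
  have uP' : {in S, forall v, u v != v -> (u v \in ~: P) = (v \notin ~: P)}.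
    by move=> v vS nuv; rewrite !in_setC uP.
  have SP : S :&: P = P.
    by apply/setIidPr/subsetP=> v; rewrite !inE => /eqP <-; have [] := fP i v.
  have etaE : eta L c = #|P| + #|S :\: P| by rewrite -[in #|P|]SP cardsID.
  (* The class of [c] and its complement in [S] differ by at most one in size, and their sizes add
     up to [eta L c]. *)
  have := card_setI_le uS u1 uP; have := card_setI_le uS u1 uP'.
  rewrite -setDE [S :\: ~: P]setDE setCK SP etaE /ceil_divn /=.
  by move: #|P| #|S :\: P| => m n; lia.
- move=> i c v cL nMv; rewrite !fE ?ML //.
  have tE : t' (v, c) = (M c v, c) by rewrite t'E /t //= xpair_eqE (negPf nMv).
  have [] := bP (v, c); rewrite ?inE // tE => _ -> //; last by rewrite xpair_eqE (negPf nMv).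
  by case: (b _); case: i.
- by move=> c v cL; rewrite !fE //; case: (b _).
Qed.

(** * Pairing patterns on five path positions *)

Fixpoint bitseqs n : seq bitseq :=
  if n is n'.+1 then [seq b :: bs | b <- [:: true; false], bs <- bitseqs n'] else [:: [::]].

Lemma mem_bitseqs n (bs : bitseq) : size bs = n -> bs \in bitseqs n.
Proof. move=> <- {n}; by elim: bs => // b bs IH; apply/allpairsP; exists (b, bs); case: b. Qed.

(** The default [i] fixes every position beyond the list. *)
Definition partner (m : seq nat) i := nth i m i.

(* Below, u and w tell which of the at most five path vertices have c, respectively d,
   in their list.  The bit b_i says whether the i-th vertex takes c (d, if c is not in its
   list), and r = false complements the coloring. *)
Definition takes_c (u b : bitseq) r i := nth false u i && (nth false b i == r).
Definition takes_d (u w b : bitseq) r i :=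
  nth false w i && (nth false u i (+) nth false b i == r).

Definition links (m : seq nat) (u : bitseq) (x : nat -> bool) :=
  all (fun i => [&& nth false u i, nth false u (partner m i) & partner m i != i]
                ==> (x (partner m i) == ~~ x i)) (iota 0 5).

Definition independent (x : nat -> bool) := all (fun i => ~~ (x i && x i.+1)) (iota 0 4).

(* Candidate pairings for c and for d, as involutions of the path positions; found by an
   exhaustive search. *)
Definition patterns : seq (seq nat * seq nat) :=
  [:: ([:: 0; 2; 1; 4; 3], [:: 1; 0; 3; 2; 4]);
      ([:: 1; 0; 3; 2; 4], [:: 4; 2; 1; 3; 0]);
      ([:: 0; 2; 1; 3; 4], [:: 1; 0; 2; 4; 3]);
      ([:: 1; 0; 2; 4; 3], [:: 0; 2; 1; 3; 4])].

Definition pattern_works (u w : bitseq) (p : seq nat * seq nat) :=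
  all (fun b => if links p.1 u (takes_c u b true) && links p.2 w (takes_d u w b true) then
        has (fun r => independent (takes_c u b r) && independent (takes_d u w b r))
            [:: true; false] else true) (bitseqs 5).

(** A check of all pairs of bit sequences with equal middle bits. In the application both middle
    bits are true if the path has a third vertex, whose list is then [c] and [d], and both are false
    otherwise. *)
Lemma exists_pattern (u w : bitseq) :
    size u = 5 -> size w = 5 -> nth false u 2 = nth false w 2 ->
  exists2 p, p \in patterns & pattern_works u w p.
Proof.
move=> su sw E; apply/hasP.
have : all (fun u => all (fun w => if nth false u 2 == nth false w 2 then
         has (pattern_works u w) patterns else true) (bitseqs 5)) (bitseqs 5) by vm_compute.
move/allP/(_ u (mem_bitseqs su))/allP/(_ w (mem_bitseqs sw)).
by rewrite E eqxx.
Qed.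

Lemma partner_involutive p m i : p \in patterns -> m \in [:: p.1; p.2; [:: 1; 0; 2; 4; 3]] ->
  partner m (partner m i) = i.
Proof.
have [i5|i5] := ltnP i 5; last first.
  move=> pP mP; suff E j : 5 <= j -> partner m j = j by rewrite !E // E.
  move=> j5; rewrite /partner nth_default //.
  have : all (fun p => all (fun m => size m <= 5) [:: p.1; p.2; [:: 1; 0; 2; 4; 3]]) patterns.
    by [].
  by move/allP/(_ p pP)/allP/(_ m mP) => /leq_trans; apply.
move=> pP mP; have : all (fun p => all (fun m => all (fun i => partner m (partner m i) == i)
    (iota 0 5)) [:: p.1; p.2; [:: 1; 0; 2; 4; 3]]) patterns by [].
by move/allP/(_ p pP)/allP/(_ m mP)/allP/(_ i); rewrite mem_iota => /(_ i5)/eqP.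
Qed.

(** * Sufficiency: one short path and a matching *)

(** The edges outside [s] form a matching; pairing the ends of each at every common colour rules out
    conflicts there, for a coloring and its complement alike. So the choice between the two remains
    free for [s], whose consecutive vertices need not be adjacent. *)
Lemma path_and_matching_choosable (T : finType) (e : rel T) l (x0 : T) (s : seq T) :
    symmetric e -> irreflexive e -> uniq s -> size s <= 5 ->
    {in s, forall x y, e x y -> y \in s /\
      ((index y s == (index x s).+1) || (index x s == (index y s).+1))} ->
    (forall x y z, x \notin s -> e x y -> e x z -> y = z) ->
  proportionally_choosable e 2 l.
Proof.
move=> e_sym e_irr us s5 es eout L L2.
have out_closed x y : x \notin s -> e x y -> y \notin s.
  by move=> xs exy; apply: contra xs => ys; rewrite e_sym in exy; have [] := es y ys x exy.
(* If [s] has fewer than three vertices, this is the list of the default [x0], which serves as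
   well. *)
have [c0 [d0 [cd L3]]] := cards2P _ (introT eqP (L2 (nth x0 s 2))).
pose bits c := mkseq (fun i => (i < size s) && (c \in L (nth x0 s i))) 5.
pose u := bits c0; pose w := bits d0.
have bitsE c i : i < 5 -> nth false (bits c) i = (i < size s) && (c \in L (nth x0 s i)).
  exact: nth_mkseq.
have [|||p pP pw] := @exists_pattern u w; [by rewrite size_mkseq|by rewrite size_mkseq| |].
  by rewrite !bitsE // L3 !inE !eqxx orbT.
(* Colours other than [c0] and [d0] are absent from the middle list; for them, positions 0 and 1 are
   paired, and so are 3 and 4. *)
pose m c := if c == c0 then p.1 else if c == d0 then p.2 else [:: 1; 0; 2; 4; 3].
have mK c : involutive (partner (m c)).
  move=> i; apply: (partner_involutive _ pP); rewrite /m.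
  by case: eqP => _; [|case: eqP => _]; rewrite !inE eqxx ?orbT.
(* The default [v] leaves a vertex unpaired when its partner position lies beyond the end of [s], or
   when it lies outside [s] and has no neighbour. *)
pose mate c v := if v \in s then nth v s (partner (m c) (index v s))
                 else odflt v [pick z | e v z].
have mateK c : involutive (mate c).
  move=> v; rewrite {2}/mate; case: ifP => vs.
    have [js|js] := ltnP (partner (m c) (index v s)) (size s); last first.
      by rewrite nth_default // /mate vs nth_default.
    by rewrite /mate mem_nth // index_uniq // mK; rewrite (set_nth_default v) ?nth_index ?index_mem.
  case: pickP => [z evz|no] /=; last by rewrite /mate vs; case: pickP => // z; rewrite no.
  have zs : z \notin s by apply: out_closed evz; rewrite vs.
  rewrite /mate (negPf zs); case: pickP => [t|/(_ v)] /=; last by rewrite e_sym evz.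
  by move=> ezt; apply: eout zs ezt _; rewrite e_sym.
pose M c v := if (c \in L v) && (c \in L (mate c v)) then mate c v else v.
have MK c : involutive (M c).
  move=> v; rewrite {2}/M; case: ifP => [/andP[cv cm]|cv]; last by rewrite /M cv.
  by rewrite /M mateK cv cm.
have ML c v : (c \in L (M c v)) = (c \in L v).
  by rewrite /M; case: ifP => // /andP[-> ->].
have [f [fL fbal fM fswap]] := balanced_choices L2 MK ML.
pose b := mkseq (fun i => if nth false u i then f true (nth x0 s i) == c0
                          else f true (nth x0 s i) == d0) 5.
have fr r c v : c \in L v -> (f r v == c) = ((f true v == c) == r).
  by case: r => cL; [case: eqP|rewrite fswap // eqbF_neg negbK].
have cE r i : i < 5 -> takes_c u b r i = nth false u i && (f r (nth x0 s i) == c0).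
  move=> i5; rewrite /takes_c [nth _ b i]nth_mkseq //.
  by case E: (nth false u i) => //=; move: E; rewrite bitsE // => /andP[_ cL]; rewrite (fr r).
have dE r i : i < 5 -> takes_d u w b r i = nth false w i && (f r (nth x0 s i) == d0).
  move=> i5; rewrite /takes_d [nth _ b i]nth_mkseq //.
  case Ew: (nth false w i) => //=; move: (Ew); rewrite bitsE // => /andP[is0 dL].
  case Eu: (nth false u i) => /=; last by rewrite -fr.
  move: (Eu); rewrite bitsE // => /andP[_ cL]; rewrite [RHS]fr //; congr (_ == _).
  (* A vertex with both colours takes [d0] exactly when it does not take [c0], whence the exclusive
     or in [takes_d]. *)
  have /eqP E : [set c0; d0] == L (nth x0 s i).
    by rewrite eqEcard subUset !sub1set cL dL L2 cards2 cd.
  have := fL true (nth x0 s i); rewrite -E !inE; case: eqP => [-> _|_ /= /eqP ->].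
    by rewrite (negPf cd).
  by rewrite eqxx.
have sM c i : i < size s -> c \in L (nth x0 s i) ->
    partner (m c) i < size s -> c \in L (nth x0 s (partner (m c) i)) ->
    M c (nth x0 s i) = nth x0 s (partner (m c) i).
  move=> is0 ci js cj; rewrite /M /mate mem_nth // index_uniq //.
  by rewrite (set_nth_default x0) // ci cj.
have linksP c (x : nat -> bool) :
    (forall i, i < 5 -> x i = nth false (bits c) i && (f true (nth x0 s i) == c)) ->
    links (m c) (bits c) x.
  move=> xE; apply/allP => i; rewrite mem_iota => i5; apply/implyP => /and3P[ui uj nj].
  have j5 : partner (m c) i < 5.
    by rewrite ltnNge; apply: contraL uj => ?; rewrite nth_default ?size_mkseq.
  rewrite !xE // ui uj /=; move: ui uj; rewrite !bitsE // => /andP[is0 ci] /andP[js cj].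
  have MsE := sM c i is0 ci js cj.
  by rewrite -MsE fM // MsE nth_uniq.
have mc0 : m c0 = p.1 by rewrite /m eqxx.
have md0 : m d0 = p.2 by rewrite /m eqxx eq_sym (negPf cd).
have [r ind_c ind_d] : exists2 r, independent (takes_c u b r) & independent (takes_d u w b r).
  have /allP/(_ b (mem_bitseqs (size_mkseq _ _))) := pw.
  rewrite -mc0 -md0 !linksP; last 2 first.
  - by move=> i; apply: dE.
  - by move=> i; apply: cE.
  by move=> /hasP[r _ /andP[]]; exists r.
have noconf i : i.+1 < size s -> f r (nth x0 s i) != f r (nth x0 s i.+1).
  move=> is1; apply/eqP; set c := f r _ => fE.
  have i4 : i < 4 by rewrite -ltnS; apply: leq_trans s5.
  have is0 := ltnW is1; have i5 := ltnW i4.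
  have ci : c \in L (nth x0 s i) by apply: fL.
  have cj : c \in L (nth x0 s i.+1) by rewrite fE fL.
  have i_in : i \in iota 0 4 by rewrite mem_iota.
  have [c_c0|nc] := eqVneq c c0.
    have := allP ind_c i i_in; rewrite !cE // !bitsE // is0 is1 -c_c0 ci cj -fE.
    by rewrite eqxx.
  have [c_d0|nd] := eqVneq c d0.
    have := allP ind_d i i_in; rewrite !dE // !bitsE // is0 is1 -c_d0 ci cj -fE.
    by rewrite eqxx.
  have c2 : c \notin L (nth x0 s 2) by rewrite L3 !inE negb_or nc.
  have mE : m c = [:: 1; 0; 2; 4; 3] by rewrite /m (negPf nc) (negPf nd).
  have pE : partner (m c) i = i.+1.
    (* For [i] equal to 1 or 2 the edge would contain the middle vertex, which lacks [c]; for 0 and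
       3 its ends are paired at [c], so only one of them takes it. *)
    have i03 : [|| i == 0, i == 1, i == 2 | i == 3] by lia.
    case/or4P: i03 => /eqP iE.
    - by rewrite mE iE.
    - by move: c2; rewrite iE in cj; rewrite cj.
    - by move: c2; rewrite iE in ci; rewrite ci.
    - by rewrite mE iE.
  have MsE := sM c i is0 ci; rewrite pE in MsE; have {}MsE := MsE is1 cj.
  have := fM r c (nth x0 s i) ci; rewrite MsE nth_uniq // -fE eqxx gtn_eqF //.
  by move/(_ isT).
exists (f r); split=> // [x y exy|c _]; last exact: fbal.
have [xs|xs] := boolP (x \in s).
  have [ys] := es x xs y exy.
  rewrite -[in f r x](nth_index x0 xs) -[in f r y](nth_index x0 ys).
  have := index_mem x s; have := index_mem y s; rewrite xs ys => iy ix.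
  by case/orP=> /eqP E; [rewrite E noconf -?E|rewrite eq_sym E noconf -?E].
apply/eqP; set c := f r x => fE.
have cx : c \in L x by apply: fL.
have cy : c \in L y by rewrite fE fL.
have MxE : M c x = y.
  rewrite /M /mate (negPf xs); case: pickP => [z exz|/(_ y)]; last by rewrite exy.
  by rewrite /= (eout x z y) // cx cy.
have := fM r c x cx; rewrite MxE -fE eqxx.
have -> : y != x by apply: contraTneq exy => ->; rewrite e_irr.
by move/(_ isT).
Qed.

(** * Forbidden subgraphs from explicit lists *)

Fixpoint choices (ls : seq (nat * nat)) : seq (seq nat) :=
  if ls is p :: ls' then [seq a :: g | a <- [:: p.1; p.2], g <- choices ls'] else [:: [::]].

Lemma mem_choices ls g : size g = size ls ->
    (forall i, i < size ls -> nth 0 g i \in [:: (nth (0, 0) ls i).1; (nth (0, 0) ls i).2]) ->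
  g \in choices ls.
Proof.
elim: ls g => [|p ls IH] [|a g] // [sg] gP; apply/allpairsP; exists (a, g).
split=> //=; first exact: (gP 0).
by apply: IH => // i; apply: (gP i.+1).
Qed.

Definition realizes (E ls : seq (nat * nat)) (g : seq nat) :=
  all (fun p => nth 0 g p.1 != nth 0 g p.2) E &&
  all (fun a => let n := count (fun p => a \in [:: p.1; p.2]) ls in
         (count_mem a g == n %/ 2) || (count_mem a g == ceil_divn n 2)) [:: 1; 2; 3].

(* The vertices outside s get the list {0, 4}, so that the colours 1, 2, 3 occur only in s:
   [realizes] tests the balance of just these three. *)
Lemma obstruction (T : finType) (e : rel T) l (x0 : T) (s : seq T) (E ls : seq (nat * nat)) :
    4 < l -> uniq s -> size s = size ls -> all (fun p => p.1 < p.2 < 4) ls ->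
    all (fun p => e (nth x0 s p.1) (nth x0 s p.2)) E ->
    all (fun p => (p.1 < size ls) && (p.2 < size ls)) E ->
    ~~ has (realizes E ls) (choices ls) ->
  ~ proportionally_choosable e 2 l.
Proof.
case: l => // l l4 us ss lsP eE sE /hasPn noreal /=.
pose lst v := nth (0, 4) ls (index v s).
have lstP v : (lst v).1 < (lst v).2 <= 4.
  have [vs|vs] := ltnP (index v s) (size ls); last by rewrite /lst nth_default.
  by have := allP lsP _ (mem_nth (0, 4) vs) => /andP[-> /ltnW].
pose L v : {set 'I_l.+1} := [set inord (lst v).1; inord (lst v).2].
(* The palette has at least five colours, so [inord] is faithful on 0, ..., 4. *)
have inordE (a b : nat) : a <= 4 -> b <= 4 -> (@inord l a == inord b) = (a == b).
  by move=> a4 b4; rewrite -val_eqE /= !inordK // ltnS; lia.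
have L2 : assignment 2 L.
  move=> v; have /andP[lt12 le4] := lstP v.
  by rewrite cards2 inordE ?(ltn_eqF lt12) //; lia.
move/(_ L L2) => [f [fL fe fbal]].
pose g := [seq val (f v) | v <- s].
have sg : size g = size s by rewrite size_map.
have gE i : i < size ls -> nth 0 g i = f (nth x0 s i) by move=> ?; rewrite (nth_map x0) ?ss.
have in_lst v : val (f v) \in [:: (lst v).1; (lst v).2].
  have := fL v; rewrite !inE => /orP[] /eqP -> /=; rewrite inordK ?eqxx ?orbT //; have := lstP v; lia.
have g_choice : g \in choices ls.
  apply: mem_choices => [|i ils]; first by rewrite sg.
  have := in_lst (nth x0 s i); rewrite gE // /lst index_uniq ?ss //.
  by rewrite (set_nth_default (0, 0)).
have lsE : ls = [seq lst v | v <- s].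
  apply: (@eq_from_nth _ (0, 4)) => [|i ils]; first by rewrite size_map.
  by rewrite (nth_map x0) ?ss // /lst index_uniq ?ss.
have cardE (P : pred T) : (forall v, P v -> v \in s) -> #|[set v | P v]| = count P s.
  move=> Ps; rewrite -size_filter -(card_uniqP (filter_uniq P us)).
  by apply: eq_card => v; rewrite inE mem_filter; case: (boolP (P v)) => // /Ps->.
have in_s v a : 0 < a < 4 -> a \in [:: (lst v).1; (lst v).2] -> v \in s.
  move=> a3; apply: contraLR; rewrite -index_mem -leqNgt ss => vs.
  by rewrite /lst nth_default // !inE /=; lia.
have etaE a : 0 < a < 4 -> eta L (inord a) = count (fun p => a \in [:: p.1; p.2]) ls.
  move=> a3; rewrite [in RHS]lsE count_map -cardE => [|v]; last exact: in_s.
  apply: eq_card => v; rewrite !inE.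
  by have := lstP v => ?; rewrite !inordE //; lia.
have preE a : 0 < a < 4 -> #|f @^-1: [set inord a]| = count_mem a g.
  move=> a3; have fa v : (f v == inord a) = (val (f v) == a).
    by rewrite -val_eqE /= inordK //; lia.
  rewrite count_map -cardE => [|v /= /eqP fva].
    by apply: eq_card => v; rewrite !inE fa.
  by apply: (in_s v a a3); rewrite -fva in_lst.
have /negP[] := noreal g g_choice; apply/andP; split.
  apply/allP => -[i j] ijE; have /= eij := allP eE _ ijE; have /= /andP[ils jls] := allP sE _ ijE.
  by rewrite /= !gE // val_eqE fe.
apply/allP => a; have [a3 _|a3] := boolP (0 < a < 4); last by rewrite !inE; lia.
rewrite /= -etaE // -preE //.
have [/fbal[]->|npal] := boolP (inord a \in palette L); rewrite ?eqxx ?orbT //.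
have npalL v : inord a \notin L v by apply: contra npal => aL; apply/bigcupP; exists v.
rewrite /eta; have -> : [set v | inord a \in L v] = set0.
  by apply/setP => v; rewrite in_set in_set0 (negPf (npalL v)).
have -> : f @^-1: [set inord a] = set0; last by rewrite !cards0.
by apply/setP => v; rewrite !inE; apply: contraNF (npalL v) => /eqP <-.
Qed.

(** With lists {1, 2} on the claw, both colours must occur exactly twice, whereas the colour of the
    centre occurs only once. *)
Lemma choosable_no_claw (T : finType) (e : rel T) l v a b c :
    4 < l -> proportionally_choosable e 2 l -> uniq [:: v; a; b; c] ->
  e v a -> e v b -> e v c -> False.
Proof.
move=> l5 ch us eva evb evc.
apply: (@obstruction _ e l v _ [:: (0, 1); (0, 2); (0, 3)] (nseq 4 (1, 2)) l5 us) => //=.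
by rewrite eva evb evc.
Qed.

(** Odd cycles with constant lists {1, 2} have no proper coloring. On the 4-cycle, 1 and 2 each
    occur once, so 0 is taken in both pairs of opposite vertices, hence at two adjacent vertices. *)
Lemma choosable_no_cycle (T : finType) (e : rel T) l (x0 : T) (s : seq T) :
    4 < l -> proportionally_choosable e 2 l -> uniq s -> 2 < size s <= 5 -> sorted e s ->
  ~~ e (nth x0 s (size s).-1) (nth x0 s 0).
Proof.
move=> l5 ch us s5 /(sortedP x0) es; apply/negP => elast.
have [s3|s4|s6] : [\/ size s = 3, size s = 4 | size s = 5].
  by case: (size s) s5 => [|[|[|[|[|[|n]]]]]] // _; constructor.
- apply: (@obstruction _ e l x0 s [:: (0, 1); (1, 2); (2, 0)] (nseq 3 (1, 2)) l5 us) => //=.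
  by rewrite s3 /= in elast es; rewrite !es ?elast.
- apply: (@obstruction _ e l x0 s [:: (0, 1); (1, 2); (2, 3); (3, 0)]
    [:: (0, 1); (0, 2); (0, 1); (0, 2)] l5 us) => //=.
  by rewrite s4 /= in elast es; rewrite !es ?elast.
- apply: (@obstruction _ e l x0 s [:: (0, 1); (1, 2); (2, 3); (3, 4); (4, 0)]
    (nseq 5 (1, 2)) l5 us) => //=.
  by rewrite s6 /= in elast es; rewrite !es ?elast.
Qed.

(** Colour 1 occurs once, so the other end of the first path takes 0 and its middle takes 2. Colour
    3 forces 2 in the middle of the second path likewise, but 2 may occur only once. *)
Lemma choosable_no_two_paths (T : finType) (e : rel T) l s1 s2 :
    4 < l -> proportionally_choosable e 2 l -> uniq (s1 ++ s2) ->
    size s1 = 3 -> size s2 = 3 -> sorted e s1 -> sorted e s2 ->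
  False.
Proof.
case: s1 s2 => [|x1 [|y1 [|z1 [|? ?]]]] [|x2 [|y2 [|z2 [|? ?]]]] // l5 ch us _ _.
move=> /= /and3P[exy1 eyz1 _] /and3P[exy2 eyz2 _].
apply: (@obstruction _ e l x1 _ [:: (0, 1); (1, 2); (3, 4); (4, 5)]
  [:: (0, 1); (0, 2); (0, 1); (0, 3); (0, 2); (0, 3)] l5 us) => //=.
by rewrite exy1 eyz1 exy2 eyz2.
Qed.

(** * Components of choosable graphs *)

Lemma maximal_path (T : finType) (e : rel T) (s0 : seq T) :
    uniq s0 -> sorted e s0 ->
  exists s, [/\ uniq s, sorted e s, {subset s0 <= s} &
    forall z, z \notin s -> ~~ sorted e (z :: s) && ~~ sorted e (rcons s z)].
Proof.
have [n] := ubnP (#|T| - size s0); elim: n s0 => // n IHn s0; rewrite ltnS => le_n us es.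
have grow s1 z : z \notin s0 -> s1 =i z :: s0 -> size s1 = (size s0).+1 -> sorted e s1 ->
    exists s, [/\ uniq s, sorted e s, {subset s0 <= s} &
      forall z, z \notin s -> ~~ sorted e (z :: s) && ~~ sorted e (rcons s z)].
  move=> zs s1E ss1 es1; have us0z : uniq (z :: s0) by rewrite /= zs.
  have us1 : uniq s1 by rewrite (eq_uniq _ s1E).
  have szT : (size s0).+1 <= #|T| by have := max_card (mem (z :: s0)); rewrite (card_uniqP us0z).
  have [||//|s [? ? sub ?]] := IHn s1; first by rewrite ss1; lia.
    by [].
  by exists s; split=> // x xs0; apply: sub; rewrite s1E inE xs0 orbT.
case: (pickP [pred z | (z \notin s0) && (sorted e (z :: s0) || sorted e (rcons s0 z))]).
  move=> z /= /andP[zs /orP[?|?]]; first by apply: (grow (z :: s0) z).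
  by apply: (grow (rcons s0 z) z); rewrite ?size_rcons // => x; rewrite mem_rcons.
move=> no; exists s0; split=> // z zs; have := no z; rewrite /= zs /= => /negbT.
by rewrite negb_or.
Qed.

(** A maximal path through [x] exhausts the component: a further neighbour of an end would extend
    the path, and one of an inner vertex would give a claw. *)
Lemma choosable_component (T : finType) (e : rel T) l (x : T) :
    symmetric e -> 4 < l -> proportionally_choosable e 2 l ->
  exists s, [/\ uniq s, sorted e s & s =i connect e x].
Proof.
move=> e_sym l5 ch.
have [//|//|s [us es xs smax]] := @maximal_path T e [:: x].
exists s; split=> //.
have {}xs : x \in s by apply: xs; rewrite inE.
have clos y z : y \in s -> e y z -> z \in s.
  move=> ys eyz; apply/negPn/negP => zs; have /andP[] := smax z zs.
  have [s1 [s2 sE]] : exists s1 s2, s = s1 ++ y :: s2.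
    by case/splitPr: ys => s1 s2; exists s1, s2.
  rewrite sE in zs us es * => nl nr.
  case/lastP: s1 {sE} => [|s1 a] in zs us es nl nr *.
    by case/negP: nl; rewrite /= e_sym eyz.
  case: s2 => [|b s2] in zs us es nl nr *.
    by case/negP: nr; rewrite -cats1 -catA sorted_cat_cons -cats1 es /= eyz.
  move: es us zs; rewrite cat_rcons sorted_cat_cons => /andP[_ /and3P[eay eyb _]].
  rewrite cat_uniq mem_cat => /and3P[_ _ /= /and4P[ays ybs _ _]].
  rewrite !inE !negb_or => /and5P[_ za zy zb _].
  apply: (@choosable_no_claw _ _ _ y a b z l5 ch) => //; last by rewrite e_sym.
  move: ays ybs; rewrite /= !inE !negb_or => /and3P[ay ab _] /andP[yb _].
  by rewrite (eq_sym y a) (eq_sym y z) (eq_sym a z) (eq_sym b z) ay yb zy ab za zb.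
have cs : connect_sym e by apply: sym_connect_sym.
have cl : closed e [in s] by apply: intro_closed => // y z eyz ys; apply: clos ys eyz.
move=> y; apply/idP/idP => [ys|xy]; last by rewrite -[_ \in s](closed_connect cl xy).
case: s es xs ys {us smax clos cl} => // a s es xs ys.
rewrite inE; apply: (connect_trans (y := a)); first by rewrite cs (path_connect es).
exact: path_connect es _ ys.
Qed.

(** Six consecutive vertices split into two disjoint paths on 3 vertices. *)
Lemma choosable_component_size (T : finType) (e : rel T) l (s : seq T) :
    4 < l -> proportionally_choosable e 2 l -> uniq s -> sorted e s -> size s <= 5.
Proof.
move=> l5 ch us es; rewrite leqNgt; apply/negP => s6.
have s3 : size (take 3 s) = 3 by rewrite size_takel // ltnW // ltnW // ltnW.
apply: (@choosable_no_two_paths _ e l (take 3 s) (take 3 (drop 3 s)) l5 ch) => //.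
- by rewrite -takeD take_uniq.
- by apply: size_takel; rewrite size_drop ltn_subRL.
- exact: take_sorted.
- by apply: take_sorted; apply: drop_sorted.
Qed.

(** A chord closes the segment between its ends to a cycle, of length at most 5 by the bound on
    paths. *)
Lemma choosable_no_chord (T : finType) (e : rel T) l (s : seq T) x y :
    symmetric e -> 4 < l -> proportionally_choosable e 2 l -> uniq s -> sorted e s ->
    x \in s -> y \in s -> index x s < index y s -> e x y -> index y s = (index x s).+1.
Proof.
move=> e_sym l5 ch us es xs ys; set i := index x s; set j := index y s => ij exy.
apply/eqP; rewrite eqn_leq ij andbT leqNgt; apply/negP => ij2.
have js : j < size s by rewrite index_mem.
have s5 := choosable_component_size l5 ch us es.
pose t := take (j - i).+1 (drop i s).
have st : size t = (j - i).+1 by rewrite size_takel // size_drop; lia.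
have := @choosable_no_cycle _ e l x t l5 ch; rewrite st take_uniq ?drop_uniq //.
rewrite /= !nth_take // !nth_drop addn0 subnKC ?(ltnW ij) // !nth_index // e_sym exy.
by move=> no; have := no isT _ (take_sorted _ (drop_sorted _ es)) => /(_ ltac:(lia)).
Qed.

(** * The two implications of the characterization *)

Lemma choosable_linear_forest (T : finType) (e : rel T) l :
    symmetric e -> irreflexive e -> 0 < #|T| -> 4 < l -> proportionally_choosable e 2 l ->
  linear_forest e /\ largest_le_others_le e 5 2.
Proof.
move=> e_sym e_irr T0 l5 ch.
have compP C : C \in components e -> exists s, [/\ uniq s, sorted e s & s =i C].
  case/imsetP => x _ ->; have [s [us es sE]] := choosable_component x e_sym l5 ch.
  by exists s; split=> // y; rewrite sE !inE.
split=> [C /compP[s [us es sC]]|].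
  exists s; split=> // x y; rewrite -!sC => xs ys.
  apply/idP/orP => [exy|].
    have [lt_xy|lt_yx|/esym eq_xy] := ltngtP (index x s) (index y s).
    - by left; rewrite (choosable_no_chord e_sym l5 ch us es xs ys lt_xy exy).
    - by right; rewrite e_sym in exy; rewrite (choosable_no_chord e_sym l5 ch us es ys xs lt_yx exy).
    - by rewrite (index_inj x ys _ eq_xy) ?e_irr in exy.
  move/(sortedP x): es => es.
  have ix : index x s < size s by rewrite index_mem.
  have iy : index y s < size s by rewrite index_mem.
  case=> /eqP E; rewrite E in ix iy; [|rewrite e_sym].
    by rewrite -(nth_index x xs) -[in e _ y](nth_index x ys) E es.
  by rewrite -(nth_index x xs) -[in e y](nth_index x ys) E es.
have /card_gt0P[x0 _] := T0.
pose C0 := [set y | connect e x0 y].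
have C0c : C0 \in components e by apply/imsetP; exists x0 => //; apply/setP => y; rewrite !inE.
pose C := [arg max_(D > C0 in components e) #|D|].
have [Cc Cmax] : C \in components e /\ forall D, D \in components e -> #|D| <= #|C|.
  by rewrite /C; case: arg_maxnP.
have [s [us es sC]] := compP C Cc.
have cardE (D : {set T}) r : uniq r -> r =i D -> #|D| = size r.
  by move=> ur rD; rewrite -(card_uniqP ur); apply: eq_card => y; rewrite -rD.
exists C; split=> //; first by rewrite (cardE C s) // (choosable_component_size l5 ch).
(* If [D] has at least three vertices, so has [C] by maximality, and their spanning paths begin with
   two disjoint paths on 3 vertices. *)
move=> D Dc nDC; rewrite leqNgt; apply/negP => D3; have C3 := leq_trans D3 (Cmax D Dc).
have [r [ur er rD]] := compP D Dc; rewrite (cardE D r) // in D3; rewrite (cardE C s) // in C3.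
apply: (@choosable_no_two_paths _ e l (take 3 s) (take 3 r) l5 ch).
- rewrite cat_uniq !take_uniq // andbT /=; apply/hasPn => y /mem_take.
  rewrite rD => yD; apply/negP => /mem_take; rewrite sC => yC.
  case/negP: nDC; apply/eqP; have cs := sym_connect_sym e_sym.
  case/imsetP: Dc yD => a _ ->; case/imsetP: Cc yC => c _ ->; rewrite !inE /= => cy ay.
  apply/setP => z; rewrite !inE /=.
  by rewrite (same_connect cs ay) (same_connect cs cy).
- exact: size_takel.
- exact: size_takel.
- exact: take_sorted.
- exact: take_sorted.
Qed.

(** The path spanning the largest component serves as [s]. A vertex elsewhere with two distinct
    neighbours would lie in a component of at least three vertices. *)
Lemma linear_forest_choosable (T : finType) (e : rel T) l :
    symmetric e -> irreflexive e -> 0 < #|T| ->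
    linear_forest e -> largest_le_others_le e 5 2 -> proportionally_choosable e 2 l.
Proof.
move=> e_sym e_irr T0 lf [C [Cc _ C5 others]].
have /card_gt0P[x0 _] := T0.
have [s [us sC es]] := lf C Cc.
have cs := sym_connect_sym e_sym.
have Ccl x y : x \in C -> e x y -> y \in C.
  case/imsetP: Cc => a _ ->; rewrite !inE /= => ax exy.
  exact: connect_trans ax (connect1 exy).
apply: (@path_and_matching_choosable T e l x0 s) => //.
- by rewrite -(card_uniqP us) (eq_card sC).
- move=> x xs y exy; rewrite sC in xs; have yC := Ccl x y xs exy.
  by rewrite sC yC; split=> //; rewrite -es.
move=> x y z xs exy exz; rewrite sC in xs; apply/eqP/negPn/negP => nyz.
pose D := [set w | connect e x w].
have Dc : D \in components e by apply/imsetP; exists x => //; apply/setP => w; rewrite !inE.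
have nDC : D != C by apply: contraNneq xs => <-; rewrite inE connect0.
have := others D Dc nDC; rewrite leqNgt => /negP[].
have u3 : uniq [:: x; y; z].
  rewrite /= !inE negb_or nyz !andbT.
  by apply/andP; split; [move: exy|move: exz]; apply: contraTneq => <-; rewrite e_irr.
apply: leq_trans (_ : #|[:: x; y; z]| <= _); first by rewrite (card_uniqP u3).
apply/subset_leq_card/subsetP => w; rewrite !inE => /or3P[]/eqP->; by rewrite ?connect0 ?connect1.
Qed.

Theorem theorem11 (l : nat) (l_ge5 : 5 <= l)
    (T : finType) (e : rel T) (e_sym : symmetric e) (e_irr : irreflexive e)
    (T_gt0 : 0 < #|T|) :
  proportionally_choosable e 2 l <->
  linear_forest e /\ largest_le_others_le e 5 2.
Proof.
split; first exact: choosable_linear_forest.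
by case=> lf big; apply: linear_forest_choosable.
Qed.
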